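(* Let $n\ge2$, let $Gr_n$ be the grid graph on $\{0,\dots,2^n\}^2$ with edges between vertices at $\ell_1$-distance $1$, directed edge set $E(Gr_n)=\{uv:v\in\{u+(1,0),u+(0,1)\}\}$, and the $\ell_1$-metric; let $th(uv)=1/|E(Gr_n)|$ for all $uv\in E(Gr_n)$. Let $T=\bigcup_{k=0}^{n-2}T_k$, $T_k=\{1,2,3,4\}^k$, $|t|=k$ for $t\in T_k$. Let $C_2,C_4\in[\tfrac12,\infty)$ and let $\{\mu_t\}_{t\in T}$ be signed measures on $V(Gr_n)$ of total mass $0$ such that for all $t\in T$: (P2) $\mathrm{dist}(\mathrm{supp}(\mu_t),\mathrm{supp}(\mu_{t'}))\ge C_2^{-1}2^{n-\max(|t|,|t'|)}$ for every $t'\in T\setminus\{t\}$; (P4) $|\mu_t(A)|\le C_4\min\{2^{-n-1-|t|},4^{-n}(\mathrm{diam}(A)+1)\}$ for every $A\subseteq V(Gr_n)$; (P5) there is $u\in V(Gr_n)$ such that $\mathrm{supp}(\mu_t)\cup\{u\}$ induces a connected subgraph. Then for all $f:V(Gr_n)\to\mathbb{R}$, $$\sum_{k=0}^{n-2}\Big(\sum_{t\in T_k}\Big|\int f\,d\mu_t\Big|^2\Big)^{1/2}\le C\sum_{uv\in E(Gr_n)}|f(u)-f(v)|\,th(uv),$$ where $C\le C_4(20+40C_2)$.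
   Context: $\mathrm{supp}(\mu)=\{v:\mu(\{v\})\ne0\}$; diam and dist use the $\ell_1$-metric. *)

(* Defs.v *)
From HB Require Import structures.
From mathcomp Require Import all_boot all_order all_algebra.
From mathcomp Require Export reals.
From mathcomp Require Export all_boot all_order all_algebra.
Set Implicit Arguments. Unset Strict Implicit. Unset Printing Implicit Defensive.
Import Order.TTheory GRing.Theory Num.Theory.

Definition V (n : nat) : finType := ('I_(2 ^ n).+1 * 'I_(2 ^ n).+1)%type.

Definition absdiff (a b : nat) : nat := (a - b) + (b - a).

Definition dist1 n (u v : V n) : nat :=
  absdiff u.1 v.1 + absdiff u.2 v.2.

Definition dedge n (u v : V n) : bool :=
  ((v.1 : nat) == u.1.+1) && ((v.2 : nat) == u.2)
  || ((v.1 : nat) == u.1) && ((v.2 : nat) == u.2.+1).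

Definition Edges n : {set V n * V n} := [set e | dedge e.1 e.2].

Definition adj n (u v : V n) : bool := dist1 u v == 1%N.

Definition induced_connected n (S : {set V n}) : Prop :=
  forall x y, x \in S -> y \in S ->
    connect [rel a b | [&& a \in S, b \in S & adj a b]] x y.

(* diameter of A (0 for the empty set) *)
Definition diam n (A : {set V n}) : nat :=
  \max_(p in setX A A) dist1 p.1 p.2.

Local Open Scope ring_scope.

(* signed measure on V n given by its point masses *)
Definition meas (R : realType) n (mu : V n -> R) (A : {set V n}) : R :=
  \sum_(v in A) mu v.

Definition supp (R : realType) n (mu : V n -> R) : {set V n} :=
  [set v | mu v != 0].

Definition integral (R : realType) n (f mu : V n -> R) : R :=
  \sum_(v : V n) f v * mu v.

(* Main.v *)
(** Both sides are compared cut by cut. Subtracting a multiple of the indicator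
    of a set [S] whose boundary vertices are connected under king moves
    ([l_infinity]-distance at most 1) lowers the number of edges on which [f]
    varies, and the total variation splits additively; so it suffices to treat
    indicators of such sets. Let [m] be the number of boundary edges of [S].

    By (P5) every [mu_t] with [mu_t(S) <> 0] has a support point on the boundary,
    and by (P2) these points are separated, so at level [k] there are at most
    [max(1, 8 C2 m 2^(k-n))] of them. On the levels where [8 C2 m 2^k < 2^n] at
    most one [t] contributes in total, and since [S] or its complement has
    diameter less than [8 m], (P4) bounds it by [8 C4 m 4^-n]. On the remaining
    levels [|mu_t(S)| <= C4 2^(-n-1-k)] and the counting bound give a geometric
    series with sum at most [16 C2 C4 m 4^-n]. Finally [|E| <= (5/2) 4^n]. *)

Require Import Defs.
From HB Require Import structures.
From mathcomp Require Import all_boot all_order all_algebra.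
From mathcomp Require Import reals.
From mathcomp Require Import zify ring lra.
Set Implicit Arguments.
Unset Strict Implicit.
Unset Printing Implicit Defensive.
Import Order.TTheory GRing.Theory Num.Theory.
Local Open Scope ring_scope.

(** * Grid geometry, king moves and boundaries *)

Definition pt n (i j : nat) : V n := (inord i, inord j).

Definition king n (x y : V n) : bool :=
  (absdiff x.1 y.1 <= 1)%N && (absdiff x.2 y.2 <= 1)%N.

(** Both endpoints of a cut edge are included, so [S] and its complement have the same boundary. *)
Definition vboundary n (S : {set V n}) : {set V n} :=
  [set x | [exists y, adj x y && ((x \in S) != (y \in S))]].

Definition eboundary n (S : {set V n}) : {set V n * V n} :=
  [set e in Edges n | (e.1 \in S) != (e.2 \in S)].

(** King steps make any two corners of a unit square neighbours, which [connected_cut] relies on. *)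
Definition king_connected n (W : {set V n}) : Prop :=
  forall x y, x \in W -> y \in W ->
    connect [rel a b | [&& a \in W, b \in W & king a b]] x y.

Lemma pt_coord n (x : V n) : pt n x.1 x.2 = x.
Proof. by case: x => a b; rewrite /pt !inord_val. Qed.

Lemma pt1 n i j : (i <= 2 ^ n)%N -> (pt n i j).1 = i :> nat.
Proof. by move=> h; rewrite /= inordK. Qed.

Lemma pt2 n i j : (j <= 2 ^ n)%N -> (pt n i j).2 = j :> nat.
Proof. by move=> h; rewrite /= inordK. Qed.

Lemma dist1C n (x y : V n) : dist1 x y = dist1 y x.
Proof. by rewrite /dist1 /absdiff; lia. Qed.

Lemma dist1_eq0 n (x y : V n) : (dist1 x y == 0%N) = (x == y).
Proof.
apply/eqP/eqP => [|->]; last by rewrite /dist1 /absdiff !subnn.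
rewrite /dist1 /absdiff => h; rewrite -(pt_coord x) -(pt_coord y); congr pt; lia.
Qed.

Lemma dist1_triangle n (y x z : V n) : (dist1 x z <= dist1 x y + dist1 y z)%N.
Proof. by rewrite /dist1 /absdiff; lia. Qed.

Lemma dist1_le n (x y : V n) : (dist1 x y <= 2 * 2 ^ n)%N.
Proof.
have := ltn_ord x.1; have := ltn_ord x.2; have := ltn_ord y.1.
by have := ltn_ord y.2; rewrite /dist1 /absdiff; lia.
Qed.

Lemma king_dist1 n (x y : V n) : king x y -> (dist1 x y <= 2)%N.
Proof. by rewrite /king /dist1; lia. Qed.

Lemma adj_king n (x y : V n) : adj x y -> king x y.
Proof. by rewrite /adj /king /dist1; lia. Qed.

Lemma kingC n (x y : V n) : king x y = king y x.
Proof. by rewrite /king /absdiff; lia. Qed.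

Lemma adjC n (x y : V n) : adj x y = adj y x.
Proof. by rewrite /adj dist1C. Qed.

Lemma adj_dedge n (x y : V n) : adj x y = dedge x y || dedge y x.
Proof. by rewrite /adj /dedge /dist1 /absdiff; lia. Qed.

(** * Extracting one king-connected piece of a cut *)

(* On a grid a mod 2 one-form closed on unit squares is exact; it is integrated
   along the bottom row and then up a column. *)
Lemma xor_integral N (h v : nat -> nat -> bool) :
  (forall i j, (i < N)%N -> (j < N)%N ->
     h i j (+) v i.+1 j = v i j (+) h i j.+1) ->
  exists F : nat -> nat -> bool,
    (forall i j, (i < N)%N -> (j <= N)%N -> F i j (+) F i.+1 j = h i j) /\
    (forall i j, F i j (+) F i j.+1 = v i j).
Proof.
move=> closed.
pose F i j := (\big[addb/false]_(a < i) h a 0%N) (+) \big[addb/false]_(b < j) v i b.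
have Fv i j : F i j (+) F i j.+1 = v i j.
  rewrite /F big_ord_recr /=.
  by case: (\big[addb/false]_(a < i) _); case: (\big[addb/false]_(b < j) _);
    case: (v i j).
exists F; split=> // i j ltiN; elim: j => [_|j IH ltjN].
  by rewrite /F !big_ord0 big_ord_recr /=; case: (\big[addb/false]_(a < i) _);
    case: (h i 0%N).
have := closed i j ltiN ltjN; rewrite -(IH (ltnW ltjN)) -!Fv.
by case: (F i j); case: (F i.+1 j); case: (F i j.+1); case: (F i.+1 j.+1);
   case: (h i j.+1).
Qed.

(** A [w] symmetric on adjacent pairs is a mod 2 one-form; the set where a primitive of it is true
    has [w] as its differential. *)
Lemma cut_of_closed_form n (w : V n -> V n -> bool) :
  (forall x y, adj x y -> w x y = w y x) ->
  (forall i j, (i < 2 ^ n)%N -> (j < 2 ^ n)%N ->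
     w (pt n i j) (pt n i.+1 j) (+) w (pt n i.+1 j) (pt n i.+1 j.+1) =
     w (pt n i j) (pt n i j.+1) (+) w (pt n i j.+1) (pt n i.+1 j.+1)) ->
  exists S : {set V n}, forall x y, adj x y -> (x \in S) (+) (y \in S) = w x y.
Proof.
move=> wC /(@xor_integral _ (fun i j => w (pt n i j) (pt n i.+1 j))
  (fun i j => w (pt n i j) (pt n i j.+1))) [F [Fh Fv]].
exists [set x : V n | F x.1 x.2].
have D x y : dedge x y ->
    (x \in [set x : V n | F x.1 x.2]) (+) (y \in [set x : V n | F x.1 x.2]) = w x y.
  rewrite !inE; case/orP=> /andP[/eqP e1 /eqP e2].
    rewrite -{3}(pt_coord x) -{3}(pt_coord y) e1 e2 Fh // -ltnS //.
    by rewrite -e1.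
  by rewrite -{3}(pt_coord x) -{3}(pt_coord y) e1 e2 Fv.
move=> x y axy; have := axy; rewrite adj_dedge => /orP[/D //|/D e].
by rewrite addbC e wC // adjC.
Qed.

Lemma vboundaryP n (S : {set V n}) (x : V n) :
  reflect (exists2 y, adj x y & (x \in S) != (y \in S)) (x \in vboundary S).
Proof.
rewrite inE; apply: (iffP existsP) => [[y /andP[a b]]|[y a b]]; exists y => //.
exact/andP.
Qed.

Lemma vboundary_adj n (S : {set V n}) (x y : V n) :
  adj x y -> (x \in S) != (y \in S) -> x \in vboundary S /\ y \in vboundary S.
Proof.
move=> a d; split; apply/vboundaryP; first by exists y.
by exists x; rewrite 1?adjC 1?eq_sym.
Qed.

(* [W] is the king-component of [w0] in the boundary of [S]. Restricting the
   mod 2 differential of [S] to [W] keeps it closed on every unit square, since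
   boundary vertices of a common square lie in the same component; so it is the
   differential of some [S1], which agrees with [S] or with its complement on
   all of [W]. *)
Lemma connected_cut n (S : {set V n}) (w0 : V n) : w0 \in vboundary S ->
  exists S' : {set V n},
    [/\ w0 \in vboundary S', king_connected (vboundary S')
      & {in vboundary S', forall x, (x \in S') = (x \in S)} ].
Proof.
move=> w0S.
pose r := [rel a b | [&& a \in vboundary S, b \in vboundary S & king a b]].
have rC : symmetric r by move=> a b /=; rewrite kingC andbCA.
have cC := sym_connect_sym rC.
pose W := [set x | connect r w0 x].
have WS x : x \in W -> x \in vboundary S.
  rewrite inE => /connectP[p]; elim/last_ind: p => [_ ->//|p y _].
  by rewrite rcons_path last_rcons => /andP[_ /and3P[_ h _]] ->.
have Wk x y : x \in W -> y \in vboundary S -> king x y -> y \in W.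
  move=> xW yS k; have xS := WS _ xW; move: xW; rewrite !inE => xW.
  by apply: connect_trans xW (connect1 _); rewrite /= xS yS.
pose s x := x \in S.
pose w x y := (x \in W) && (s x (+) s y).
have wC x y : adj x y -> w x y = w y x.
  move=> a; rewrite /w (addbC (s y)); case d: (s x (+) s y); rewrite ?andbF //.
  have [xS yS] : x \in vboundary S /\ y \in vboundary S.
    by apply: vboundary_adj => //; move: d; rewrite /s; do 2!case: (_ \in S).
  rewrite !andbT; apply/idP/idP => h; first by apply: (Wk x) => //; exact: adj_king.
  by apply: (Wk y) => //; rewrite kingC; exact: adj_king.
have [S1 S1w] : exists S1 : {set V n}, forall x y, adj x y ->
    (x \in S1) (+) (y \in S1) = w x y.
  apply: cut_of_closed_form => // i j ltiN ltjN.
  set a := pt n i j; set b := pt n i.+1 j; set c := pt n i.+1 j.+1.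
  set d := pt n i j.+1.
  have coords : [/\ (a.1 = i :> nat) /\ (a.2 = j :> nat),
     (b.1 = i.+1 :> nat) /\ (b.2 = j :> nat), (c.1 = i.+1 :> nat) /\ (c.2 = j.+1 :> nat)
     & (d.1 = i :> nat) /\ (d.2 = j.+1 :> nat)].
    by do !split; rewrite ?pt1 ?pt2 // ltnW.
  pose Q := [:: a; b; c; d].
  have kQ : {in Q &, forall x y, king x y}.
    move=> x y; rewrite !inE => /or4P[]/eqP-> /or4P[]/eqP->;
    by rewrite /king /absdiff; move: coords => [[? ?] [? ?] [? ?] [? ?]]; lia.
  have [aab abc aad adc] : [/\ adj a b, adj b c, adj a d & adj d c].
    by rewrite /adj /dist1 /absdiff; move: coords => [[? ?] [? ?] [? ?] [? ?]]; split; lia.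
  (* If a corner of the square lies in [W], so do all its boundary corners, and on the edges of the
     square [w] is the full differential of [S]; otherwise [w] vanishes there. *)
  have [/hasP[z zQ zW]|/hasPn noW] := boolP (has (mem W) Q).
    have wQ x y : x \in Q -> y \in Q -> adj x y -> w x y = s x (+) s y.
      move=> xQ yQ axy; rewrite /w; case dxy: (s x (+) s y); rewrite ?andbF //.
      have [xS _] : x \in vboundary S /\ y \in vboundary S.
        by apply: vboundary_adj => //; move: dxy; rewrite /s; do 2!case: (_ \in S).
      by rewrite (Wk z) // kQ.
    rewrite !wQ ?inE ?eqxx ?orbT //.
    by case: (s a); case: (s b); case: (s c); case: (s d).
  have w0Q x y : x \in Q -> w x y = false by move=> /noW /= /negbTE h; rewrite /w h.
  by rewrite !w0Q // ?inE ?eqxx ?orbT.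
(* [t] records where [S1] and [S] disagree; it is constant along every edge with an end in [W]. *)
pose t x := (x \in S1) (+) s x.
have tadj x y : x \in W -> adj x y -> t x = t y.
  move=> xW /S1w; rewrite /w xW /= /t.
  by case: (s x); case: (s y); case: (x \in S1); case: (y \in S1).
have tking x y : x \in W -> y \in W -> king x y -> t x = t y.
  (* A diagonal step turns at the corner [z]. Each half starts at [x] or at [y], so [z] itself may
     lie outside [W]. *)
  move=> xW yW kxy; pose z : V n := (x.1, y.2).
  have -> : t x = t z.
    case: (eqVneq x z) => [<-//|nxz]; apply: tadj => //.
    have : dist1 x z != 0%N.
      by rewrite dist1_eq0.
    by move: kxy; rewrite /king /adj /dist1 /absdiff /z /=; lia.
  case: (eqVneq y z) => [<-//|nyz]; apply/esym; apply: tadj => //.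
  have : dist1 y z != 0%N.
    by rewrite dist1_eq0.
  by move: kxy; rewrite /king /adj /dist1 /absdiff /z /=; lia.
have w0W : w0 \in W by rewrite inE connect0.
have tW x : x \in W -> t x = t w0.
  move=> xW; have := xW; rewrite inE => /connectP[p].
  elim/last_ind: p x xW => [x _ _ ->//|p y IH x xW].
  rewrite rcons_path last_rcons => /andP[pp /and3P[lS yS k]] ->.
  have lW : last w0 p \in W by rewrite inE; apply/connectP; exists p.
  rewrite -(IH (last w0 p)) //; apply: tking => //; last by rewrite kingC.
  by apply: (Wk (last w0 p)).
(* Flipping [S1] by the constant value of [t] on [W] makes it agree with [S] there and keeps its
   differential. *)
pose S' := [set x | (x \in S1) (+) t w0].
have S'w x y : adj x y -> ((x \in S') != (y \in S')) = w x y.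
  move=> /S1w <-; rewrite !inE.
  by case: (x \in S1); case: (y \in S1); case: (t w0).
have bW x : (x \in vboundary S') = (x \in W).
  apply/vboundaryP/idP => [[y axy]|xW]; first by rewrite S'w // => /andP[].
  have /vboundaryP[y axy d] := WS _ xW; exists y => //; rewrite S'w // /w xW /=.
  by move: d; rewrite /s; do 2!case: (_ \in S).
exists S'; split; first by rewrite bW.
  move=> x y; rewrite !bW => xW yW.
  have : connect r x y.
    by move: xW yW; rewrite !inE => xW; apply: connect_trans; rewrite cC.
  case/connectP => p pp ->; apply/connectP; exists p => //.
  elim: p x xW pp => //= z p IH x xW /andP[/and3P[xS zS k] pp].
  have zW : z \in W by apply: (Wk x).
  by rewrite !bW xW zW k IH.
move=> x; rewrite bW => xW; rewrite inE -(tW _ xW) /t /s.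
by case: (x \in S1); case: (x \in S).
Qed.

(** * Size and diameter of king-connected boundaries *)

Lemma card_vboundary n (S : {set V n}) : (#|vboundary S| <= 2 * #|eboundary S|)%N.
Proof.
have sub : vboundary S \subset (fst @: eboundary S) :|: (snd @: eboundary S).
  apply/subsetP=> x /vboundaryP[y]; rewrite adj_dedge inE => /orP[d|d] dS; apply/orP.
    by left; apply/imsetP; exists (x, y); rewrite ?inE //=; apply/andP.
  right; apply/imsetP; exists (y, x); rewrite ?inE //=; apply/andP; split=> //.
  by rewrite eq_sym.
apply: leq_trans (subset_leq_card sub) _; apply: leq_trans (leq_card_setU _ _) _.
by rewrite mul2n -addnn leq_add // leq_imset_card.
Qed.

(** A king step changes the distance to [p] by at most 2, so half of it, rounded up, moves by at
    most 1 along a king path and skips no value. *)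
Lemma king_ivt n (W : {set V n}) (p q : V n) (k : nat) :
  king_connected W -> p \in W -> q \in W -> (2 * k <= (dist1 p q).+1)%N ->
  exists2 w, w \in W & uphalf (dist1 p w) = k.
Proof.
move=> Wc pW qW kle; case: k kle => [|k] kle.
  by exists p; rewrite // /dist1 /absdiff !subnn.
have [/existsP[w /andP[wW /eqP wk]]|] :=
  boolP [exists w, (w \in W) && (uphalf (dist1 p w) == k.+1)].
  by exists w.
rewrite negb_exists => /forallP noW.
have : (dist1 p q <= 2 * k)%N; last by lia.
have /connectP[s ps ->] := Wc p q pW qW.
have : (dist1 p p <= 2 * k)%N by rewrite /dist1 /absdiff !subnn.
elim: s {1 3 5}p ps => //= z s IH x /andP[/and3P[_ zW kxz] ps] xk.
apply: IH ps _; have := noW z; rewrite zW /=.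
have := dist1_triangle x p z; have := king_dist1 kxz; lia.
Qed.

(** The rounded halves [0], ..., [k] of the distance are all attained inside the ball, at distinct
    points. *)
Lemma card_king_ball n (W : {set V n}) (p q : V n) (k : nat) :
  king_connected W -> p \in W -> q \in W -> (2 * k <= (dist1 p q).+1)%N ->
  (k < #|[set w in W | (dist1 p w <= 2 * k)%N]|)%N.
Proof.
move=> Wc pW qW kle; set Z := [set w in W | _].
have all_i (i : 'I_k.+1) : exists2 w, w \in Z & uphalf (dist1 p w) = i.
  have lti := ltn_ord i.
  have [|w wW wi] := king_ivt (k := i) Wc pW qW; first by lia.
  by exists w => //; rewrite inE wW; lia.
have : [set: 'I_k.+1] \subset (fun w => inord (uphalf (dist1 p w))) @: Z.
  apply/subsetP=> i _; have [w wZ wi] := all_i i; apply/imsetP; exists w => //.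
  by rewrite wi inord_val.
by move/subset_leq_card; rewrite cardsT card_ord => /leq_trans; apply; exact: leq_imset_card.
Qed.

Lemma king_diam n (W : {set V n}) (p q : V n) :
  king_connected W -> p \in W -> q \in W -> (dist1 p q <= 2 * (#|W| - 1))%N.
Proof.
move=> Wc pW qW.
have := @card_king_ball n W p q (uphalf (dist1 p q)) Wc pW qW.
have -> : (2 * uphalf (dist1 p q) <= (dist1 p q).+1)%N by lia.
move/(_ isT) => h; have : (uphalf (dist1 p q) < #|W|)%N; last by lia.
by apply: leq_trans h (subset_leq_card _); apply/subsetP=> w; rewrite inE => /andP[].
Qed.

(** The balls of radius [r/2] around the points are disjoint. Each holds at least [r/4] points of
    [W], because [W] contains another point of the family at distance [r] or more; hence the
    condition [1 < #|P|]. *)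
Lemma packing n (W : {set V n}) (I : finType) (P : {set I}) (v : I -> V n) (r : nat) :
  king_connected W -> {in P, forall i, v i \in W} ->
  {in P &, forall i j, i != j -> (r <= dist1 (v i) (v j))%N} ->
  (1 < #|P|)%N -> (#|P| * r <= 4 * #|W|)%N.
Proof.
move=> Wc vW sep P2; case: r sep => [|r] sep; first by rewrite muln0.
pose Z i := [set w in W | (2 * dist1 (v i) w < r.+1)%N].
have cZ i : i \in P -> (r.+1 <= 4 * #|Z i|)%N.
  move=> iP; have [j jP nij] : exists2 j, j \in P & i != j.
    move: P2; rewrite (cardsD1 i) iP add1n ltnS card_gt0 => /set0Pn[j].
    by rewrite !inE eq_sym => /andP[? ?]; exists j.
  (* Here [r] is the separation minus one, so [r %/ 4 + 1] is at least a quarter of the separation,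
     and points within [2 * (r %/ 4)] of [v i] lie in [Z i]. *)
  have := @card_king_ball n W (v i) (v j) (r %/ 4) Wc (vW _ iP) (vW _ jP).
  have := sep i j iP jP nij => rd.
  have -> : (2 * (r %/ 4) <= (dist1 (v i) (v j)).+1)%N by lia.
  move/(_ isT) => h.
  have : ((r %/ 4) < #|Z i|)%N; last by lia.
  apply: leq_trans h (subset_leq_card _).
  by apply/subsetP=> w; rewrite !inE => /andP[-> /=]; lia.
have dis i j : i \in P -> j \in P -> i != j -> [disjoint Z i & Z j].
  move=> iP jP nij; apply/pred0Pn => -[w /=]; rewrite !inE => /andP[/andP[_ a] /andP[_ b]].
  have := sep i j iP jP nij; have := dist1_triangle w (v i) (v j).
  by rewrite (dist1C w); lia.
have : (\sum_(i in P) #|Z i| <= #|W|)%N.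
  rewrite -sum1_card.
  rewrite (eq_bigr (fun i => (\sum_(w in W) (w \in Z i))%N)); last first.
    by move=> i _; rewrite -sum1_card big_mkcond [RHS]big_mkcond; apply: eq_bigr => w _;
      rewrite !inE; case: (w \in W).
  rewrite exchange_big /=; apply: leq_sum => w _.
  have [/existsP[i /andP[iP wi]]|] := boolP [exists i, (i \in P) && (w \in Z i)].
    rewrite (bigD1 i) //= wi big1 // => j /andP[jP nji].
    by have := dis _ _ jP iP nji => /pred0P /(_ w) /=; rewrite wi andbT => ->.
  rewrite negb_exists => /forallP h; rewrite big1 // => i iP.
  by have := h i; rewrite iP /= => /negbTE ->.
move=> h; rewrite -sum_nat_const.
apply: (@leq_trans (\sum_(i in P) 4 * #|Z i|)%N); first exact: leq_sum.
by rewrite -big_distrr leq_mul2l.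
Qed.

Lemma row_constant n (S : {set V n}) (j : 'I_(2 ^ n).+1) :
  (forall w, w \in vboundary S -> w.2 != j) ->
  forall i i' : 'I_(2 ^ n).+1, ((i, j) \in S) = ((i', j) \in S).
Proof.
move=> noW.
have base k : (k <= 2 ^ n)%N -> ((inord k : 'I_(2 ^ n).+1, j) \in S) = ((ord0, j) \in S).
  elim: k => [_|k IH kN]; first by congr ((_, _) \in S); apply/val_inj; rewrite /= inordK.
  rewrite -IH 1?ltnW //; apply/eqP; apply: contraT => d.
  have [|h _] := @vboundary_adj n S (inord k.+1, j) (inord k, j) _ d.
    by rewrite /adj /dist1 /absdiff /= !inordK //; [lia|exact: ltnW].
  by have := noW _ h; rewrite /= eqxx.
by move=> i i'; rewrite -(inord_val i) -(inord_val i') !base // -ltnS.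
Qed.

Lemma col_constant n (S : {set V n}) (i : 'I_(2 ^ n).+1) :
  (forall w, w \in vboundary S -> w.1 != i) ->
  forall j j' : 'I_(2 ^ n).+1, ((i, j) \in S) = ((i, j') \in S).
Proof.
move=> noW.
have base k : (k <= 2 ^ n)%N -> ((i, inord k : 'I_(2 ^ n).+1) \in S) = ((i, ord0) \in S).
  elim: k => [_|k IH kN]; first by congr ((_, _) \in S); apply/val_inj; rewrite /= inordK.
  rewrite -IH 1?ltnW //; apply/eqP; apply: contraT => d.
  have [|h _] := @vboundary_adj n S (i, inord k.+1) (i, inord k) _ d.
    by rewrite /adj /dist1 /absdiff /= !inordK //; [lia|exact: ltnW].
  by have := noW _ h; rewrite /= eqxx.
by move=> j j'; rewrite -(inord_val j) -(inord_val j') !base // -ltnS.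
Qed.

Lemma diam_leq n (A : {set V n}) (d : nat) :
  {in A &, forall x y, (dist1 x y <= d)%N} -> (diam A <= d)%N.
Proof.
by move=> h; apply/bigmax_leqP => -[x y]; rewrite inE => /andP[xA yA]; apply: h.
Qed.

(** If the boundary meets every column or every row, it has more than [2 ^ n] vertices and the
    diameter of the whole grid suffices. Otherwise some column and some row avoid it; they cross, so
    they lie on one side, and [A] is the other side. *)
Lemma small_side n (S : {set V n}) :
  king_connected (vboundary S) -> vboundary S != set0 ->
  exists2 A : {set V n}, A = S \/ A = ~: S & ((diam A).+1 <= 8 * #|eboundary S|)%N.
Proof.
move=> Wc W0; have cW := card_vboundary S.
have Wgt0 : (0 < #|vboundary S|)%N by rewrite card_gt0.
suff [A AS dA] : exists2 A : {set V n}, A = S \/ A = ~: S &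
    (diam A <= 4 * (#|vboundary S| - 1))%N by exists A => //; lia.
have big (g : V n -> 'I_(2 ^ n).+1) : (forall i, exists2 w, w \in vboundary S & g w = i) ->
    exists2 A : {set V n}, A = S \/ A = ~: S & (diam A <= 4 * (#|vboundary S| - 1))%N.
  move=> h; exists S; first by left.
  have sub : [set: 'I_(2 ^ n).+1] \subset g @: vboundary S.
    by apply/subsetP=> i _; have [w wW <-] := h i; apply: imset_f.
  have := leq_trans (subset_leq_card sub) (leq_imset_card _ _).
  rewrite cardsT card_ord => lW; apply: diam_leq => x y _ _.
  by have := dist1_le x y; lia.
have [/forallP full|] := boolP [forall i : 'I_(2 ^ n).+1, [exists w in vboundary S, w.1 == i]].
  apply: (big (fun x : V n => x.1)) => i.
  by have /existsP[w /andP[wW /eqP]] := full i; exists w.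
rewrite negb_forall => /existsP[i0 /existsPn ni0].
have [/forallP full|] := boolP [forall i : 'I_(2 ^ n).+1, [exists w in vboundary S, w.2 == i]].
  apply: (big (fun x : V n => x.2)) => i.
  by have /existsP[w /andP[wW /eqP]] := full i; exists w.
rewrite negb_forall => /existsP[j0 /existsPn nj0].
have coli0 j j' : ((i0, j) \in S) = ((i0, j') \in S).
  by apply: col_constant => w wW; have := ni0 w; rewrite wW.
have rowj0 i i' : ((i, j0) \in S) = ((i', j0) \in S).
  by apply: row_constant => w wW; have := nj0 w; rewrite wW.
pose c := (i0, j0) \in S.
pose A := [set x | (x \in S) != c].
exists A.
  by case Ec: c; [right|left]; apply/setP=> x; rewrite !inE Ec; case: (x \in S).
(* If the row of [x] missed the boundary, it would be constant and would join [x] to column [i0],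
   which lies outside [A]. *)
have rowA x : x \in A -> exists2 w, w \in vboundary S & w.2 = x.2.
  move=> xA; have [/exists_inP[w wW /eqP ?]|/existsPn h] :=
    boolP [exists w in vboundary S, w.2 == x.2]; first by exists w.
  have /row_constant/(_ x.1 i0) : forall w, w \in vboundary S -> w.2 != x.2.
    by move=> w wW; have := h w; rewrite wW.
  by case: x xA {h} => x1 x2; rewrite inE /= => xA E; move: xA; rewrite E (coli0 x2 j0) eqxx.
have colA x : x \in A -> exists2 w, w \in vboundary S & w.1 = x.1.
  move=> xA; have [/exists_inP[w wW /eqP ?]|/existsPn h] :=
    boolP [exists w in vboundary S, w.1 == x.1]; first by exists w.
  have /col_constant/(_ x.2 j0) : forall w, w \in vboundary S -> w.1 != x.1.
    by move=> w wW; have := h w; rewrite wW.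
  by case: x xA {h} => x1 x2; rewrite inE /= => xA E; move: xA; rewrite E (rowj0 x1 i0) eqxx.
apply: diam_leq => x y xA yA.
have [w1 w1W e1] := rowA x xA; have [w2 w2W e2] := rowA y yA.
have [w3 w3W e3] := colA x xA; have [w4 w4W e4] := colA y yA.
have := king_diam Wc w1W w2W; have := king_diam Wc w3W w4W.
by rewrite /dist1 e1 e2 e3 e4; lia.
Qed.

(** * Edges of the grid *)

Lemma card_Edges n : (#|Edges n| <= 2 * (2 ^ n * (2 ^ n).+1))%N.
Proof.
pose I := ('I_(2 ^ n) * 'I_(2 ^ n).+1)%type.
pose g1 (p : I) := (pt n p.1 p.2, pt n p.1.+1 p.2).
pose g2 (p : I) := (pt n p.2 p.1, pt n p.2 p.1.+1).
have sub : Edges n \subset (g1 @: [set: I]) :|: (g2 @: [set: I]).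
  apply/subsetP=> -[x y]; rewrite !inE /= => /orP[]/andP[/eqP e1 /eqP e2]; apply/orP.
    have h : (x.1 < 2 ^ n)%N by rewrite -ltnS -e1.
    left; apply/imsetP; exists (Ordinal h, x.2); rewrite ?inE // /g1 /=.
    by rewrite -e1 -{2}e2 !pt_coord.
  have h : (x.2 < 2 ^ n)%N by rewrite -ltnS -e2.
  right; apply/imsetP; exists (Ordinal h, x.1); rewrite ?inE // /g2 /=.
  by rewrite -e2 -{2}e1 !pt_coord.
apply: leq_trans (subset_leq_card sub) _; apply: leq_trans (leq_card_setU _ _) _.
have cI : #|[set: I]| = (2 ^ n * (2 ^ n).+1)%N by rewrite cardsT card_prod !card_ord.
by rewrite -cI mul2n -addnn leq_add // leq_imset_card.
Qed.

Lemma constant_of_edges (T : eqType) n (f : V n -> T) :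
  (forall e, e \in Edges n -> f e.1 = f e.2) -> forall x y, f x = f y.
Proof.
move=> h; suff H i j : (i <= 2 ^ n)%N -> (j <= 2 ^ n)%N -> f (pt n i j) = f (pt n 0 0).
  by move=> x y; rewrite -(pt_coord x) -(pt_coord y) !H // -ltnS.
move=> iN; elim: j => [_|j IH jN]; last first.
  rewrite -IH 1?ltnW //; apply/esym/(h (pt n i j, pt n i j.+1)).
  rewrite inE /dedge !pt1 ?pt2 ?eqxx ?orbT //; exact: ltnW.
elim: i iN => // i IH iN; rewrite -IH 1?ltnW //; apply/esym/(h (pt n i 0, pt n i.+1 0)).
rewrite inE /dedge !pt2 ?pt1 ?eqxx ?orbT //; exact: ltnW.
Qed.

(** * Euclidean norm inequalities *)

Lemma cauchy_schwarz (R : realDomainType) (I : finType) (a b : I -> R) :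
  (\sum_i a i * b i) ^+ 2 <= (\sum_i a i ^+ 2) * (\sum_i b i ^+ 2).
Proof.
(* Lagrange's identity: this double sum is twice the Cauchy-Schwarz gap. *)
have : 0 <= \sum_i \sum_j (a i * b j - a j * b i) ^+ 2.
  by apply: sumr_ge0 => i _; apply: sumr_ge0 => j _; exact: sqr_ge0.
have -> : \sum_i \sum_j (a i * b j - a j * b i) ^+ 2 =
    \sum_i \sum_j a i ^+ 2 * b j ^+ 2 + \sum_i \sum_j b i ^+ 2 * a j ^+ 2
    - 2 * \sum_i \sum_j (a i * b i) * (a j * b j).
  rewrite mulr_sumr -big_split -sumrB; apply: eq_bigr => i _ /=.
  rewrite mulr_sumr -big_split -sumrB; apply: eq_bigr => j _ /=; ring.
have E (u v : I -> R) : \sum_i \sum_j u i * v j = (\sum_i u i) * (\sum_j v j).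
  by rewrite mulr_suml; apply: eq_bigr => i _; rewrite mulr_sumr.
by rewrite !E; nra.
Qed.

Lemma minkowski (R : rcfType) (I : finType) (a b : I -> R) :
  Num.sqrt (\sum_i `|a i + b i| ^+ 2) <=
  Num.sqrt (\sum_i `|a i| ^+ 2) + Num.sqrt (\sum_i `|b i| ^+ 2).
Proof.
under eq_bigr do rewrite real_normK ?num_real //.
under [X in _ <= Num.sqrt X + _]eq_bigr do rewrite real_normK ?num_real //.
under [X in _ <= _ + Num.sqrt X]eq_bigr do rewrite real_normK ?num_real //.
set A := \sum_i a i ^+ 2; set B := \sum_i b i ^+ 2.
have A0 : 0 <= A by apply: sumr_ge0 => i _; exact: sqr_ge0.
have B0 : 0 <= B by apply: sumr_ge0 => i _; exact: sqr_ge0.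
have sA := sqrtr_ge0 A; have sB := sqrtr_ge0 B.
have -> : \sum_i (a i + b i) ^+ 2 = A + 2 * (\sum_i a i * b i) + B.
  rewrite mulr_sumr -!big_split; apply: eq_bigr => i _ /=; ring.
rewrite -(ler_sqr (sqrtr_ge0 _)) ?nnegrE ?addr_ge0 //.
have h : \sum_i a i * b i <= Num.sqrt A * Num.sqrt B.
  rewrite -sqrtrM //; apply: le_trans (ler_norm _) _; rewrite -sqrtr_sqr.
  by apply: ler_wsqrtr; exact: cauchy_schwarz.
rewrite sqrrD !sqr_sqrtr //; first by rewrite -mulr_natl; lra.
have -> : A + 2 * (\sum_i a i * b i) + B = \sum_i (a i + b i) ^+ 2.
  rewrite mulr_sumr -!big_split; apply: eq_bigr => i _ /=; ring.
by apply: sumr_ge0 => i _; exact: sqr_ge0.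
Qed.

Lemma sqrt_sum_sparse (R : rcfType) (I : finType) (a : I -> R) (B Y : R) :
  0 <= B -> (forall i, `|a i| <= B) -> #|[set i | a i != 0]|%:R <= Y ->
  Num.sqrt (\sum_i `|a i| ^+ 2) <= Num.sqrt Y * B.
Proof.
move=> B0 aB cY; have Y0 : 0 <= Y by exact: le_trans cY.
have -> : Num.sqrt Y * B = Num.sqrt (Y * B ^+ 2) by rewrite sqrtrM // sqrtr_sqr ger0_norm.
apply: ler_wsqrtr; rewrite (bigID (mem [set i | a i != 0])) /= [X in _ + X]big1 ?addr0; last first.
  by move=> i; rewrite inE negbK => /eqP ->; rewrite normr0 expr0n.
apply: le_trans (ler_wpM2r (sqr_ge0 B) cY); rewrite mulr_natl -sumr_const.
by apply: ler_sum => i _; rewrite lerXn2r ?nnegrE.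
Qed.

(** * Measures against a cut *)

Lemma meas_setC (R : realType) n (mu : V n -> R) (S : {set V n}) :
  \sum_v mu v = 0 -> meas mu (~: S) = - meas mu S.
Proof.
move=> h; rewrite (bigID (mem S)) /= in h; apply/eqP; rewrite /meas -addr_eq0 addrC; apply/eqP.
by rewrite -[RHS]h; congr (_ + _); apply: eq_bigl => v; rewrite inE.
Qed.

Lemma integral_indicator (R : realType) n (mu : V n -> R) (S : {set V n}) :
  integral (fun x => (x \in S)%:R) mu = meas mu S.
Proof.
by rewrite /integral /meas [RHS]big_mkcond; apply: eq_bigr => v _;
  case: (v \in S); rewrite ?mul1r ?mul0r.
Qed.

(** Mass zero puts support points on both sides of [S]. A path between them through the support and
    [u] crosses the cut; the ends of the crossing edge are distinct, so one of them is not [u]. *)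
Lemma supp_meets_vboundary (R : realType) n (mu : V n -> R) (S : {set V n}) :
  \sum_v mu v = 0 -> (exists u, induced_connected (u |: supp mu)) ->
  meas mu S != 0 -> exists2 v, v \in supp mu & v \in vboundary S.
Proof.
move=> mass [u uc] muS.
have pickin (A : {set V n}) : meas mu A != 0 -> exists2 x, x \in supp mu & x \in A.
  move=> nz; have [/exists_inP[x xs xA]|/existsPn h] := boolP [exists x in supp mu, x \in A].
    by exists x.
  move: nz; rewrite /meas big1 ?eqxx // => x xA; apply/eqP; apply: contraT => nz.
  by have := h x; rewrite xA andbT inE nz.
have [x xs xS] := pickin _ muS.
have [y ys] : exists2 y, y \in supp mu & y \in ~: S.
  by apply: pickin; rewrite meas_setC // oppr_eq0.
rewrite inE => yS.
have := uc x y; rewrite !in_setU xs ys !orbT => /(_ isT isT) /connectP[p pp ey].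
rewrite ey in yS.
elim: p x xS pp {xs ey ys y} yS => /= [x -> //|z p IH x xS /andP[/and3P[xu zu a] pp] yS].
have [zS|zS] := boolP (z \in S); first exact: (IH z).
have [xb zb] : x \in vboundary S /\ z \in vboundary S by apply: vboundary_adj => //; rewrite xS (negbTE zS).
move: xu zu; rewrite !in_setU1 => /orP[/eqP ex|]; last by exists x.
case/orP=> [/eqP ez|]; last by exists z.
by move: a; rewrite ex ez /adj (eqP (etrans (dist1_eq0 _ _) (eqxx u))).
Qed.

(** * Reduction to indicators of sets *)

(* With [S] a superlevel set of [f] and [S'] one connected piece of its cut, [f]
   jumps in the same direction as the indicator of [S'] across every edge of the
   cut of [S'], so subtracting the smallest jump [d] loses no total variation. *)
Lemma cut_induction (R : realType) n (Phi : (V n -> R) -> R) (K : R) :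
  (forall f g, f =1 g -> Phi f = Phi g) ->
  (forall f, (forall x y, f x = f y) -> Phi f <= 0) ->
  (forall f g d, 0 <= d -> Phi (fun x => f x + d * g x) <= Phi f + d * Phi g) ->
  (forall S : {set V n}, king_connected (vboundary S) -> vboundary S != set0 ->
     Phi (fun x => (x \in S)%:R) <= K * #|eboundary S|%:R) ->
  forall f, Phi f <= K * \sum_(e in Edges n) `|f e.1 - f e.2|.
Proof.
move=> Pext Pcst Padd Pcut f.
(* Induction on the number of edges across which [f] varies. *)
have [m] := ubnP #|[set e in Edges n | f e.1 != f e.2]|.
elim: m f => // m IH f; rewrite ltnS => cm.
have [/existsP[e0 /andP[e0E fe0]]|/existsPn noe] :=
  boolP [exists e, (e \in Edges n) && (f e.1 != f e.2)]; last first.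
  have fe e : e \in Edges n -> f e.1 = f e.2.
    by move=> eE; apply/eqP; have := noe e; rewrite eE negbK.
  rewrite big1 ?mulr0; first by apply: Pcst; exact: constant_of_edges.
  by move=> e /fe ->; rewrite subrr normr0.
(* The smaller end value, used as a strict threshold, puts the ends of [e0] on different sides. *)
pose c := Num.min (f e0.1) (f e0.2).
pose S := [set x | c < f x].
have e0S : (e0.1 \in S) != (e0.2 \in S).
  rewrite !inE /c; move: fe0; rewrite neq_lt => /orP[lt|lt].
    by rewrite min_l ?ltW // ltxx lt.
  by rewrite min_r ?ltW // ltxx lt.
have a0 : adj e0.1 e0.2 by move: e0E; rewrite inE adj_dedge => ->.
have [b0 _] := vboundary_adj a0 e0S.
have [S' [b0' kS' S'S]] := connected_cut b0.
have be e : e \in eboundary S' -> [/\ e \in Edges n & (e.1 \in S) = (e.1 \in S')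
    /\ (e.2 \in S) = (e.2 \in S')].
  rewrite inE => /andP[eE d]; have ae : adj e.1 e.2 by move: eE; rewrite inE adj_dedge => ->.
  by have [h1 h2] := vboundary_adj ae d; split=> //; rewrite !S'S.
have [e1 e1B] : exists e1, e1 \in eboundary S'.
  have /vboundaryP[y ay d] := b0'; move: (ay); rewrite adj_dedge => /orP[]h.
    by exists (e0.1, y); rewrite !inE h.
  by exists (y, e0.1); rewrite !inE h eq_sym.
case: (@arg_minP _ _ _ e1 (fun e => e \in eboundary S') (fun e => `|f e.1 - f e.2|) e1B) => /= e2 e2B e2min.
set d := `|f e2.1 - f e2.2| in e2min.
have d0 : 0 <= d by exact: normr_ge0.
have dpos : d != 0.
  have [_ [h1 h2]] := be _ e2B; move: e2B; rewrite inE -h1 -h2 !inE => /andP[_ hd].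
  by rewrite /d normr_eq0 subr_eq0; apply: contraNneq hd => ->.
pose g x := f x + (- d) * (x \in S')%:R.
(* On a cut edge [f] is larger at the end in [S'], by at least [d], so subtracting [d] there does
   not reverse the sign. *)
have gE e : e \in eboundary S' -> `|f e.1 - f e.2| = `|g e.1 - g e.2| + d.
  move=> eB; have [_ [h1 h2]] := be _ eB; have := e2min _ eB.
  move: eB; rewrite inE => /andP[_]; rewrite /g -h1 -h2 !inE.
  case: (ltP c (f e.1)) => l1; case: (ltP c (f e.2)) => l2 // _ /=.
    by rewrite ger0_norm => [dle|]; [rewrite ger0_norm|]; lra.
  by rewrite ler0_norm => [dle|]; [rewrite ler0_norm|]; lra.
have gN e : e \in Edges n -> e \notin eboundary S' -> g e.1 - g e.2 = f e.1 - f e.2.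
  by rewrite /g !inE => ->; rewrite negbK => /eqP ->; ring.
have tvE : \sum_(e in Edges n) `|f e.1 - f e.2| =
    \sum_(e in Edges n) `|g e.1 - g e.2| + d * #|eboundary S'|%:R.
  have -> : d * #|eboundary S'|%:R = \sum_(e in Edges n) (if e \in eboundary S' then d else 0).
    rewrite mulr_natr -sumr_const -big_mkcondr; apply: eq_bigl => e.
    by rewrite !inE; case: (dedge _ _).
  rewrite -big_split; apply: eq_bigr => e eE /=.
  by case: ifPn => [/gE //|/(gN _ eE) ->]; rewrite addr0.
(* [g] varies on no new edge, and at the minimising edge [e2] its jump is zero. *)
have lt : (#|[set e in Edges n | g e.1 != g e.2]| < m)%N.
  apply: leq_trans cm; apply: proper_card; apply/properP; split.
    apply/subsetP=> e; rewrite in_set [in X in _ -> X]in_set => /andP[eE ge]; rewrite eE /=.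
    have [eB|eB] := boolP (e \in eboundary S'); last first.
      by rewrite -subr_eq0 -(gN _ eE eB) subr_eq0.
    rewrite -subr_eq0 -normr_eq0 gE // paddr_eq0 // ?negb_and ?(negbTE dpos) ?orbT //.
  exists e2; first by have [eE [h1 h2]] := be _ e2B; rewrite inE eE /= -subr_eq0 -normr_eq0.
  have [eE _] := be _ e2B; rewrite inE eE negbK /= -subr_eq0 -normr_eq0.
  by have := gE _ e2B; rewrite -/d => ?; apply/eqP; lra.
have -> : Phi f = Phi (fun x => g x + d * (x \in S')%:R).
  by apply: Pext => x; rewrite /g; ring.
apply: le_trans (Padd _ _ _ d0) _; rewrite tvE mulrDr; apply: lerD; first exact: IH.
rewrite mulrCA; apply: ler_wpM2l => //; apply: Pcut => //; apply/set0Pn; by exists e0.1.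
Qed.

(** * Sums over levels *)

Lemma sum_sqrt_single (R : rcfType) (A : finType) (L : nat) (P : pred nat)
    (a : seq A -> R) (X : R) :
  0 <= X -> (forall t, (size t < L)%N -> `|a t| <= X) ->
  (forall t t', (size t < L)%N -> (size t' < L)%N -> P (size t) -> P (size t') ->
     a t != 0 -> a t' != 0 -> t = t') ->
  \sum_(0 <= k < L | P k) Num.sqrt (\sum_(t : k.-tuple A) `|a t| ^+ 2) <= X.
Proof.
move=> X0 aX uniq_t; rewrite big_mkord.
have zero k : (forall t : k.-tuple A, a t = 0) ->
    Num.sqrt (\sum_(t : k.-tuple A) `|a t| ^+ 2) = 0.
  by move=> h; rewrite big1 ?sqrtr0 // => t _; rewrite h normr0 expr0n.
(* Either every term vanishes, or a single [t] at a single level carries the whole double sum. *)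
have [/existsP[k /andP[Pk /existsP[t nz]]]|/existsPn h] :=
  boolP [exists k : 'I_L, P k && [exists t : k.-tuple A, a t != 0]]; last first.
  rewrite big1 // => k Pk; apply: zero => t; apply/eqP.
  by have := h k; rewrite Pk /= => /existsPn/(_ t); rewrite negbK.
have uz (k' : 'I_L) (t' : k'.-tuple A) : P k' -> (t' : seq A) != t -> a t' = 0.
  move=> Pk'; apply: contraNeq => nz'; apply/eqP; apply: uniq_t; rewrite ?size_tuple //.
rewrite (bigD1 k) //= [X in _ + X]big1 ?addr0; last first.
  move=> k' /andP[Pk' nk]; apply: zero => t'; apply: uz => //.
  by apply: contraNneq nk => /(congr1 size); rewrite !size_tuple => ?; apply/eqP/val_inj.
rewrite (bigD1 t) //= [X in _ + X]big1 ?addr0; last first.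
  by move=> t' nt; rewrite (uz k) // normr0 expr0n.
by rewrite sqrtr_sqr normr_id aX ?size_tuple.
Qed.

Lemma geometric_tail (R : realFieldType) (K L : nat) :
  \sum_(0 <= k < L | (K <= k)%N) (3 / 4 : R) ^+ (k - K) <= 4.
Proof.
(* The explicit remainder makes the induction work; by truncated subtraction the right side is 0 as
   long as [L <= K]. *)
suff : \sum_(0 <= k < L | (K <= k)%N) (3 / 4 : R) ^+ (k - K) <= 4 - 4 * (3 / 4) ^+ (L - K).
  have : 0 <= (3 / 4 : R) ^+ (L - K) by apply: exprn_ge0; lra.
  lra.
elim: L => [|L IH]; first by rewrite big_nil sub0n expr0; lra.
rewrite big_mkcond big_nat_recr //= -big_mkcond; case: leqP => KL.
  by rewrite subSn // exprS; lra.
move: IH; have -> : (L - K = 0)%N by lia.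
have -> : (L.+1 - K = 0)%N by lia.
by lra.
Qed.

(** * The estimate for one cut *)

Lemma cut_bound (R : realType) (n : nat) (C2 C4 : R)
  (mu : seq 'I_4 -> V n -> R) (S : {set V n}) :
  (2 <= n)%N -> 2^-1 <= C2 -> 0 <= C4 ->
  (forall t : seq 'I_4, (size t <= n - 2)%N -> \sum_(v : V n) mu t v = 0) ->
  (forall t t' : seq 'I_4, (size t <= n - 2)%N -> (size t' <= n - 2)%N ->
     t' != t -> forall v w, v \in supp (mu t) -> w \in supp (mu t') ->
       C2^-1 * (2 ^+ (n - maxn (size t) (size t'))%N) <= (dist1 v w)%:R) ->
  (forall t : seq 'I_4, (size t <= n - 2)%N -> forall A : {set V n},
       `|meas (mu t) A| <= C4 * Num.min ((2 ^+ (n + 1 + size t)%N)^-1)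
                                        ((4 ^+ n)^-1 * ((diam A)%:R + 1))) ->
  (forall t : seq 'I_4, (size t <= n - 2)%N ->
     exists u : V n, induced_connected (u |: supp (mu t))) ->
  king_connected (vboundary S) -> vboundary S != set0 ->
  \sum_(0 <= k < n.-1)
     Num.sqrt (\sum_(t : k.-tuple 'I_4) `|meas (mu t) S| ^+ 2)
  <= C4 * (8 + 16 * C2) / 4 ^+ n * #|eboundary S|%:R.
Proof.
move=> n2 hC2 C40 Hmass HP2 HP4 HP5 kS S0.
have szn k : (k < n.-1)%N -> (k <= n - 2)%N by lia.
have W0 : (0 < #|vboundary S|)%N by rewrite card_gt0.
have Wm := card_vboundary S.
set m := #|eboundary S| in Wm *.
have m0 : (0 < m)%N by lia.
have m1 : 1 <= m%:R :> R by rewrite ler1n.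
have p2 k : 0 < 2 ^+ k :> R by apply: exprn_gt0.
have p4 : 0 < 4 ^+ n :> R by apply: exprn_gt0.
have b1 t : (size t <= n - 2)%N -> `|meas (mu t) S| <= C4 / 2 ^+ (n + 1 + size t).
  move=> st; apply: le_trans (HP4 t st S) _; apply: ler_wpM2l => //.
  by rewrite ge_min lexx.
(* The second bound of (P4) is applied to the side of small diameter; mass zero makes the two sides
   agree up to sign. *)
have b2 t : (size t <= n - 2)%N -> `|meas (mu t) S| <= C4 / 4 ^+ n * (8 * m%:R).
  have [A AS dA] := small_side kS S0.
  move=> st; have -> : `|meas (mu t) S| = `|meas (mu t) A|.
    by case: AS => -> //; rewrite meas_setC ?normrN //; exact: Hmass.
  apply: le_trans (HP4 t st A) _; rewrite -mulrA; apply: ler_wpM2l => //.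
  rewrite ge_min; apply/orP; right; apply: ler_wpM2l; first by rewrite invr_ge0 ltW.
  by rewrite -natrM natr1 ler_nat.
pose nz t := meas (mu t) S != 0.
(* The default vertex occurs only if no support point lies on the boundary, which [vP] excludes
   under [nz t]. *)
pose v t := odflt (pt n 0 0) [pick x | (x \in supp (mu t)) && (x \in vboundary S)].
have vP t : (size t <= n - 2)%N -> nz t -> v t \in supp (mu t) /\ v t \in vboundary S.
  move=> st nzt; rewrite /v; case: pickP => [x /andP[] //|no].
  have [x xs xb] := supp_meets_vboundary (Hmass t st) (HP5 t st) nzt.
  by have := no x; rewrite xs xb.
(* Any common bound [k] on the two levels is allowed, so one estimate serves both [count] and
   [single]. *)
have sep k t t' : (k <= n - 2)%N -> (size t <= k)%N -> (size t' <= k)%N -> nz t -> nz t' ->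
    t != t' -> 2 ^+ n <= C2 * 2 ^+ k * (dist1 (v t) (v t'))%:R.
  move=> kn tk t'k nt nt' ntt'.
  have st := leq_trans tk kn; have st' := leq_trans t'k kn.
  have [vs _] := vP t st nt; have [vs' _] := vP t' st' nt'.
  have := HP2 t t' st st'; rewrite eq_sym => /(_ ntt' _ _ vs vs') h.
  have C2p : 0 < C2 by lra.
  rewrite -ler_pdivrMl ?mulr_gt0 // invfM -mulrA; apply: le_trans h.
  rewrite ler_pM2l ?invr_gt0 // ler_pdivrMl // -exprD ler_eXn2l ?ltr1n //.
  by clear -tk t'k kn; lia.
(* The packing bound at level [k]: four times at most [2 m] boundary vertices, divided by the
   separation [2^(n-k) / C2]. *)
pose y k : R := 8 * C2 * m%:R * 2 ^+ k / 2 ^+ n.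
have y0 k : 0 <= y k.
  by apply: divr_ge0; last exact: ltW; apply: mulr_ge0; last exact: ltW; nra.
have yS k j : y (k + j)%N = y k * 2 ^+ j by rewrite /y exprD; field; rewrite lt0r_neq0.
(* [K] is the first level at which this bound reaches 1; one exists since [y n = 8 C2 m] is at least
   4. *)
have [K yK Kmin] : exists2 K, 1 <= y K & forall k, (k < K)%N -> y k < 1.
  have ex : exists k, 1 <= y k.
    exists n; rewrite /y -mulrA mulfV ?lt0r_neq0 // mulr1; nra.
  case: (ex_minnP ex) => K yK minK; exists K => // k; rewrite ltnNge ltNge.
  by apply: contra => /minK.
have count k : (k < n.-1)%N -> (K <= k)%N ->
    #|[set t : k.-tuple 'I_4 | meas (mu t) S != 0]|%:R <= y k.
  move=> kn Kk; set N := #|_|.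
  have yk : 1 <= y k.
    rewrite -(subnKC Kk) yS; have : 1 <= 2 ^+ (k - K) :> R by apply: exprn_ege1; lra.
    by nra.
  have [N1|N1] := leqP N 1; first by apply: le_trans yk; rewrite lern1.
  (* Distances are integers, so the real separation may be rounded up to the least integer [r];
     [2 ^ n.+1] qualifies since [C2 >= 1/2]. *)
  have ex : exists r : nat, 2 ^+ n <= C2 * 2 ^+ k * r%:R.
    exists (2 ^ n.+1)%N; rewrite natrX exprS.
    have : 1 <= 2 ^+ k :> R by apply: exprn_ege1; lra.
    have := p2 n; set a := 2 ^+ n; set b := 2 ^+ k => a0 b1'.
    have : 1 <= C2 * b * 2 by nra.
    by nra.
  case: (ex_minnP ex) => r rP rmin.
  have := @packing n (vboundary S) _ [set t : k.-tuple 'I_4 | meas (mu t) S != 0] v r kS.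
  have h1 : {in [set t : k.-tuple 'I_4 | meas (mu t) S != 0],
      forall i : k.-tuple 'I_4, v i \in vboundary S}.
    by move=> t; rewrite inE => nt; apply: (vP t _ nt).2; rewrite size_tuple szn.
  have h2 : {in [set t : k.-tuple 'I_4 | meas (mu t) S != 0] &,
      forall i j : k.-tuple 'I_4, i != j -> (r <= dist1 (v i) (v j))%N}.
    move=> t t'; rewrite !inE => nt nt' ntt'; apply: rmin.
    by apply: sep; rewrite ?size_tuple ?szn.
  move=> /(_ h1 h2 N1); rewrite -/N => Nr.
  have {}Nr : (N * r)%:R <= 8 * m%:R :> R by rewrite -natrM ler_nat; clear -Nr Wm; lia.
  rewrite /y ler_pdivlMr //; apply: le_trans (ler_wpM2l (ler0n _ _) rP) _.
  rewrite natrM in Nr.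
  have c0 : 0 <= C2 * 2 ^+ k by apply: mulr_ge0; [lra|exact: ltW].
  by have := ler_wpM2l c0 Nr; lra.
(* Below level [K] the separation is more than [8 m], while the boundary has diameter at most
   [4 m]. *)
have single t t' : (size t < n.-1)%N -> (size t' < n.-1)%N -> (size t < K)%N ->
    (size t' < K)%N -> nz t -> nz t' -> t = t'.
  move=> st st' tK t'K nt nt'; apply/eqP; apply: contraT => ntt'.
  pose k := maxn (size t) (size t').
  have kn : (k <= n - 2)%N by rewrite geq_max !szn.
  have kK : (k < K)%N by rewrite gtn_max tK t'K.
  have := sep k t t' kn (leq_maxl _ _) (leq_maxr _ _) nt nt' ntt'.
  have := Kmin k kK; rewrite /y ltr_pdivrMr // mul1r => h1 h2.
  have : (dist1 (v t) (v t'))%:R <= 4 * m%:R :> R.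
    rewrite -natrM ler_nat.
    have := king_diam kS (vP t (szn _ st) nt).2 (vP t' (szn _ st') nt').2.
    by clear -Wm; lia.
  have c0 : 0 < C2 * 2 ^+ k by apply: mulr_gt0; [lra|].
  move/(ler_wpM2l (ltW c0)) => h3.
  have : 0 < C2 * 2 ^+ k * m%:R by apply: mulr_gt0 => //; lra.
  by lra.
have low : \sum_(0 <= k < n.-1 | (k < K)%N)
    Num.sqrt (\sum_(t : k.-tuple 'I_4) `|meas (mu t) S| ^+ 2) <= C4 / 4 ^+ n * (8 * m%:R).
  apply: (@sum_sqrt_single _ _ _ (fun k => k < K)%N (fun t => meas (mu t) S)).
  - by rewrite mulr_ge0 ?divr_ge0 ?mulr_ge0 ?ler0n // ltW.
  - by move=> t /szn/b2.
  - exact: single.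
have high k : (k < n.-1)%N -> (K <= k)%N ->
    Num.sqrt (\sum_(t : k.-tuple 'I_4) `|meas (mu t) S| ^+ 2) <=
    C4 * (4 * C2 * m%:R) / 4 ^+ n * (3 / 4) ^+ (k - K).
  move=> kn Kk.
  have B0 : 0 <= C4 / 2 ^+ (n + 1 + k) by rewrite divr_ge0 // ltW.
  have aB (t : k.-tuple 'I_4) : `|meas (mu t) S| <= C4 / 2 ^+ (n + 1 + k).
    by have := b1 t; rewrite size_tuple => /(_ (szn _ kn)).
  apply: le_trans (sqrt_sum_sparse B0 aB (count k kn Kk)) _.
  (* sqrt 2 <= 3/2 and 1 <= y K *)
  have sy : Num.sqrt (y k) <= y K * (3 / 2) ^+ (k - K).
    have q0 : 0 <= y K * (3 / 2) ^+ (k - K) by apply: mulr_ge0 => //; apply: exprn_ge0; lra.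
    rewrite -(ger0_norm q0) -sqrtr_sqr; apply: ler_wsqrtr.
    rewrite -{1}(subnKC Kk) yS exprMn -exprM mulnC exprM expr2 -mulrA.
    apply: ler_wpM2l => //.
    have h : 2 ^+ (k - K) <= ((3 / 2) ^+ 2) ^+ (k - K) :> R.
      by apply: lerXn2r; rewrite ?nnegrE; clear; lra.
    by have := p2 (k - K)%N; nra.
  apply: le_trans (ler_wpM2r B0 sy) _; rewrite le_eqVlt; apply/orP; left; apply/eqP.
  (* Growth [3/2] from the count against decay [1/2] of the bound on each measure leaves the ratio
     [3/4]. *)
  have -> : (3 / 2 : R) ^+ (k - K) = (3 / 4) ^+ (k - K) * 2 ^+ (k - K).
    by rewrite -exprMn; congr (_ ^+ _); field.
  have -> : 2 ^+ (n + 1 + k) = 2 * 2 ^+ n * 2 ^+ K * 2 ^+ (k - K) :> R.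
    by rewrite -exprS -!exprD; congr (_ ^+ _); clear -Kk; lia.
  have -> : 4 ^+ n = 2 ^+ n * 2 ^+ n :> R by rewrite -exprMn; congr (_ ^+ _); ring.
  by rewrite /y; field; rewrite !lt0r_neq0.
rewrite (bigID (fun k => k < K)%N) /=.
have : \sum_(0 <= k < n.-1 | ~~ (k < K)%N)
    Num.sqrt (\sum_(t : k.-tuple 'I_4) `|meas (mu t) S| ^+ 2) <=
    C4 * (4 * C2 * m%:R) / 4 ^+ n * 4.
  apply: (@le_trans _ _ (\sum_(0 <= k < n.-1 | (K <= k)%N)
    C4 * (4 * C2 * m%:R) / 4 ^+ n * (3 / 4) ^+ (k - K))).
    under eq_bigl do rewrite -leqNgt.
    rewrite big_nat_cond [X in _ <= X]big_nat_cond.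
    by apply: ler_sum => k /andP[/andP[_ kn] Kk]; exact: high.
  rewrite -mulr_sumr; apply: ler_wpM2l; last exact: geometric_tail.
  by rewrite divr_ge0 ?(ltW p4) // mulr_ge0 // ; nra.
(* In units of [C4 m / 4^n], the levels below [K] contribute 8 and the others [4 * 4 C2]. *)
by move: low; lra.
Qed.

(** * From cuts to arbitrary functions *)

Theorem theorem3p7 (R : realType) (n : nat) (hn : (2 <= n)%N)
  (C2 C4 : R) (hC2 : 2^-1 <= C2) (hC4 : 2^-1 <= C4)
  (mu : seq 'I_4 -> V n -> R)
  (Hmass : forall t : seq 'I_4, (size t <= n - 2)%N ->
     \sum_(v : V n) mu t v = 0)
  (HP2 : forall t t' : seq 'I_4, (size t <= n - 2)%N -> (size t' <= n - 2)%N ->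
     t' != t ->
     forall v w, v \in supp (mu t) -> w \in supp (mu t') ->
       C2^-1 * (2 ^+ (n - maxn (size t) (size t'))%N) <= (dist1 v w)%:R)
  (HP4 : forall t : seq 'I_4, (size t <= n - 2)%N ->
     forall A : {set V n},
       `|meas (mu t) A| <=
         C4 * Num.min ((2 ^+ (n + 1 + size t)%N)^-1)
                      ((4 ^+ n)^-1 * ((diam A)%:R + 1)))
  (HP5 : forall t : seq 'I_4, (size t <= n - 2)%N ->
     exists u : V n, induced_connected (u |: supp (mu t))) :
  forall f : V n -> R,
    \sum_(0 <= k < n.-1)
       Num.sqrt (\sum_(t : k.-tuple 'I_4) `|integral f (mu (val t))| ^+ 2)
    <= C4 * (20 + 40 * C2) *
       \sum_(e in Edges n) `|f e.1 - f e.2| * (#|Edges n|%:R)^-1.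
Proof.
move=> f; have C40 : 0 <= C4 by lra.
have p4 : 0 < 4 ^+ n :> R by apply: exprn_gt0.
(* Each summand is the Euclidean norm of a linear map in [g], so [Phi] is subadditive; it vanishes
   on constants because the masses are zero. *)
pose Phi g := \sum_(0 <= k < n.-1)
   Num.sqrt (\sum_(t : k.-tuple 'I_4) `|integral g (mu (val t))| ^+ 2).
have bound : Phi f <=
    C4 * (8 + 16 * C2) / 4 ^+ n * \sum_(e in Edges n) `|f e.1 - f e.2|.
  apply: cut_induction => [g h gh|g cst|g h d d0|S kS S0].
  - apply: eq_bigr => k _; congr Num.sqrt; apply: eq_bigr => t _.
    by congr (`|_| ^+ 2); apply: eq_bigr => x _; rewrite gh.
  - rewrite /Phi big_nat big1 // => k /andP[_ kn].
    rewrite big1 ?sqrtr0 // => t _; rewrite /integral.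
    rewrite (eq_bigr (fun x => g (pt n 0 0) * mu t x)).
      by rewrite -mulr_sumr Hmass ?mulr0 ?normr0 ?expr0n // size_tuple; lia.
    by move=> x _; rewrite (cst x (pt n 0 0)).
  - rewrite /Phi mulr_sumr -big_split /=; apply: ler_sum => k _.
    have -> : d * Num.sqrt (\sum_(t : k.-tuple 'I_4) `|integral h (mu t)| ^+ 2) =
        Num.sqrt (\sum_(t : k.-tuple 'I_4) `|d * integral h (mu t)| ^+ 2).
      rewrite -{1}(ger0_norm d0) -sqrtr_sqr -sqrtrM ?sqr_ge0 // mulr_sumr.
      by congr Num.sqrt; apply: eq_bigr => t _; rewrite normrM exprMn (ger0_norm d0).
    apply: le_trans (minkowski _ _); rewrite le_eqVlt; apply/orP; left; apply/eqP.
    congr Num.sqrt; apply: eq_bigr => t _; congr (`|_| ^+ 2).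
    rewrite /integral mulr_sumr -big_split; apply: eq_bigr => x _ /=; ring.
  - rewrite /Phi; under eq_bigr do under eq_bigr do rewrite integral_indicator.
    exact: cut_bound HP2 HP4 HP5 kS S0.
apply: le_trans bound _; rewrite -mulr_suml mulrA [leRHS]mulrAC; apply: ler_wpM2r.
  by apply: sumr_ge0.
(* Since [n >= 2], the term [2 * 2^n] of the edge count is at most half of [4^n], which gives
   [5/2 * 4^n]. *)
have n4 : 4 <= 2 ^+ n :> R.
  have : 1 <= 2 ^+ (n - 2) :> R by apply: exprn_ege1; lra.
  by rewrite -(subnKC hn) exprD addKn expr2; lra.
have E0 : (0 < #|Edges n|)%N.
  rewrite card_gt0; apply/set0Pn; exists (pt n 0 0, pt n 1 0); rewrite inE /dedge.
  by rewrite !pt1 ?pt2 ?eqxx // expn_gt0.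
have cE : #|Edges n|%:R <= 5 / 2 * 4 ^+ n :> R.
  have : #|Edges n|%:R <= (2 * (2 ^ n * (2 ^ n).+1))%:R :> R by rewrite ler_nat card_Edges.
  rewrite !natrM -[(2 ^ n).+1%:R]natr1 natrX.
  have -> : 4 ^+ n = 2 ^+ n * 2 ^+ n :> R by rewrite -exprMn; congr (_ ^+ _); ring.
  have : 0 <= (2 ^+ n - 4) * 2 ^+ n :> R by apply: mulr_ge0; [lra|exact: exprn_ge0].
  lra.
rewrite ler_pdivrMr // mulrAC ler_pdivlMr ?ltr0n //.
have -> : C4 * (20 + 40 * C2) * 4 ^+ n = C4 * (8 + 16 * C2) * (5 / 2 * 4 ^+ n) by field.
by apply: ler_wpM2l => //; nra.
Qed.
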